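(* Let $S$ be a right loop and let $T$ be an invariant sub right loop of $S$ of order $2$ such that the quotient $S/T$ is a group. Then the group torsion $G_S$ of $S$ is an elementary abelian $2$-group.
   Context: A right loop is a set $S$ with a binary operation $\circ$ having a two-sided identity $1$ and such that for all $a,b\in S$ the equation $X\circ a=b$ has a unique solution $X\in S$. A sub right loop is a subset containing $1$ that is a right loop under the restricted operation. A congruence on a right loop $S$ is an equivalence relation $R$ on $S$ that is a sub right loop of $S\times S$ (with componentwise operation). An invariant sub right loop of $S$ is the equivalence class $R_1$ of the identity $1$ for some congruence $R$ on $S$. The quotient $S/R_1$ (also written $S/R$) is the set $\{R_1\circ x\mid x\in S\}$ with the right loop operation $(R_1\circ x)\circ(R_1\circ y)=R_1\circ(x\circ y)$. For $y,z\in S$ the map $f^S(y,z):S\to S$ is defined by letting $f^S(y,z)(x)$ be the unique solution $X$ of $X\circ(y\circ z)=(x\circ y)\circ z$; it is a bijection of $S$. The group torsion $G_S$ of $S$ is the subgroup of the symmetric group $\mathrm{Sym}(S)$ generated by $\{f^S(y,z)\mid y,z\in S\}$. An elementary abelian $2$-group is an abelian group in which every element squares to the identity (the trivial group is allowed). *)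

(* Defs.v *)
From HB Require Import structures.
From mathcomp Require Import all_boot boolp classical_sets functions cardinality.

Set Implicit Arguments.
Unset Strict Implicit.
Unset Printing Implicit Defensive.

Local Open Scope classical_set_scope.
Local Open Scope group_scope.

(* Built on [baseUMagmaType] (an operation and a constant) rather than
   [umagmaType], because the latter also requires a [choiceType]. *)
HB.mixin Record BaseUMagma_isRightLoop S of BaseUMagma S := {
  rl_mul1g : left_id (1 : S) *%g;
  rl_mulg1 : right_id (1 : S) *%g;
  rdiv_uniq : forall a b : S, exists! x : S, x * a = b
}.

#[short(type="rightLoopType")]
HB.structure Definition RightLoop :=
  {S of BaseUMagma_isRightLoop S & BaseUMagma S}.

Section RightDivision.
Variable S : rightLoopType.

(* [rdiv b a] is the unique solution X of X * a = b. *)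
Definition rdiv (b a : S) : S := projT1 (cid (rdiv_uniq a b)).

Lemma rdivK (a b : S) : rdiv b a * a = b.
Proof. by rewrite /rdiv; case: cid => x []. Qed.

Lemma mulIrl (a x y : S) : x * a = y * a -> x = y.
Proof.
move=> e; have [u [_ hu]] := rdiv_uniq a (y * a).
by rewrite -(hu x e) -(hu y erefl).
Qed.

Lemma mulKrl (a x : S) : rdiv (x * a) a = x.
Proof. by apply: (@mulIrl a); rewrite rdivK. Qed.

End RightDivision.

Section PairRightLoop.
Variables S1 S2 : rightLoopType.

Lemma pair_rl_mul1g : left_id (1 : S1 * S2) *%g.
Proof. by move=> [x y]; congr pair; rewrite /= rl_mul1g. Qed.

Lemma pair_rl_mulg1 : right_id (1 : S1 * S2) *%g.
Proof. by move=> [x y]; congr pair; rewrite /= rl_mulg1. Qed.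

Lemma pair_rdiv_uniq (a b : S1 * S2) : exists! x : S1 * S2, x * a = b.
Proof.
case: a b => [a1 a2] [b1 b2]; exists (rdiv b1 a1, rdiv b2 a2); split.
  by congr pair; rewrite /= rdivK.
by move=> [x1 x2] [<- <-]; rewrite !mulKrl.
Qed.

HB.instance Definition _ :=
  BaseUMagma_isRightLoop.Build (S1 * S2)%type
    pair_rl_mul1g pair_rl_mulg1 pair_rdiv_uniq.

End PairRightLoop.

Definition sub_right_loop (S : rightLoopType) (A : set S) : Prop :=
  [/\ A 1,
      forall a b, A a -> A b -> A (a * b) &
      forall a b, A a -> A b -> exists! x, A x /\ x * a = b].

Definition equivalence_set (T : Type) (R : set (T * T)) : Prop :=
  [/\ forall x, R (x, x),
      forall x y, R (x, y) -> R (y, x) &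
      forall x y z, R (x, y) -> R (y, z) -> R (x, z)].

Definition congruence (S : rightLoopType) (R : set (S * S)) : Prop :=
  equivalence_set R /\ sub_right_loop R.

Definition invariant_sub_right_loop (S : rightLoopType) (T : set S) : Prop :=
  exists2 R : set (S * S), congruence R & T = [set x | R (x, 1)].

Definition rl_coset (S : rightLoopType) (T : set S) (x : S) : set S :=
  [set t * x | t in T].

Lemma coset_eqP (S : rightLoopType) (R : set (S * S)) (x y : S) :
  congruence R ->
  rl_coset [set u | R (u, 1)] x = rl_coset [set u | R (u, 1)] y <-> R (x, y).
Proof.
move=> [[Rr Rs Rt] [_ RM Rd]].
have cE z : rl_coset [set u | R (u, 1)] z = [set u | R (u, z)].
  rewrite predeqE => u; split => [[t /= Rt1 <-]|/= Ruz].
    by have := RM _ _ Rt1 (Rr z); rewrite -[(t, 1) * _]/(t * z, 1 * z) rl_mul1g.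
  have [[p q] [[Rpq [e1 e2]] _]] := Rd _ _ (Rr z) Ruz.
  exists p => //=.
  by have <- : q = 1 by apply: (@mulIrl _ z); rewrite rl_mul1g.
rewrite !cE; split => [e|Rxy].
  by have : [set u | R (u, x)] x by []; rewrite e.
rewrite predeqE => u; split => /= h; first exact: Rt h Rxy.
exact: Rt h (Rs _ _ Rxy).
Qed.

Section Quotient.
Variables (S : rightLoopType) (T : set S).

Definition quotient (invT : invariant_sub_right_loop T) : Type :=
  set_type (range (rl_coset T)).

Variable invT : invariant_sub_right_loop T.
Local Notation Q := (quotient invT).

Definition quotient_class (x : S) : Q :=
  SigSub (mem_set (imageT (rl_coset T) x)).

Lemma quotient_class_surj (A : Q) : exists x, A = quotient_class x.
Proof.
case: A => A hA; have [x _ e] := set_mem hA.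
by exists x; apply: val_inj; rewrite /= e.
Qed.

Definition quotient_repr (A : Q) : S := projT1 (cid (quotient_class_surj A)).

Lemma quotient_reprK (A : Q) : quotient_class (quotient_repr A) = A.
Proof. by rewrite /quotient_repr; case: cid. Qed.

(* Well defined, hence independent of the representatives, by [quotient_mulE]. *)
Definition quotient_mul (A B : Q) : Q :=
  quotient_class (quotient_repr A * quotient_repr B).

HB.instance Definition _ := hasMul.Build Q quotient_mul.
HB.instance Definition _ := hasOne.Build Q (quotient_class 1).

Lemma quotient_mulE (x y : S) :
  quotient_class x * quotient_class y = quotient_class (x * y).
Proof.
have [R cR TE] := invT.
have classP u v : quotient_class u = quotient_class v <-> R (u, v).
  rewrite -(coset_eqP u v cR) -TE; split => [/(congr1 val)//|e].
  exact: val_inj.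
apply/classP; have [_ [_ RM _]] := cR.
have rK u : R (quotient_repr (quotient_class u), u).
  by apply/classP; rewrite quotient_reprK.
exact: RM (rK x) (rK y).
Qed.

Lemma quotient_mul1g : left_id (1 : Q) *%g.
Proof.
by move=> A; have [x ->] := quotient_class_surj A; rewrite quotient_mulE rl_mul1g.
Qed.

Lemma quotient_mulg1 : right_id (1 : Q) *%g.
Proof.
by move=> A; have [x ->] := quotient_class_surj A; rewrite quotient_mulE rl_mulg1.
Qed.

Lemma quotient_rdiv_uniq (A B : Q) : exists! X : Q, X * A = B.
Proof.
have [R cR TE] := invT.
have classP u v : quotient_class u = quotient_class v <-> R (u, v).
  rewrite -(coset_eqP u v cR) -TE; split => [/(congr1 val)//|e].
  exact: val_inj.
have [a ->] := quotient_class_surj A; have [b ->] := quotient_class_surj B.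
exists (quotient_class (rdiv b a)); split; first by rewrite quotient_mulE rdivK.
move=> X; have [x ->] := quotient_class_surj X.
rewrite quotient_mulE => /classP Rxab; apply/classP.
have [[Rr Rs _] [_ _ Rd]] := cR.
have [[p q] [[Rpq [e1 e2]] _]] := Rd _ _ (Rr a) Rxab.
have <- : p = x by apply: (@mulIrl _ a).
have <- : q = rdiv b a by apply: (@mulIrl _ a); rewrite rdivK.
exact: Rs.
Qed.

HB.instance Definition _ := BaseUMagma_isRightLoop.Build Q
  quotient_mul1g quotient_mulg1 quotient_rdiv_uniq.

End Quotient.

Definition is_group (L : rightLoopType) : Prop :=
  associative (@mul L) /\
  exists inv : L -> L, left_inverse 1 inv (@mul L) /\
                       right_inverse 1 inv (@mul L).

Section Symmetric.
Variable X : Type.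

Definition Sym : Type := set_type [set f : X -> X | bijective f].

HB.instance Definition _ := gen_eqMixin Sym.
HB.instance Definition _ := gen_choiceMixin Sym.

Definition sym_fun (s : Sym) : X -> X := val s.

Definition sym_of (f : X -> X) (bf : bijective f) : Sym := SigSub (mem_set bf).

Lemma sym_bij (s : Sym) : bijective (sym_fun s).
Proof. exact: set_mem (valP s). Qed.

Lemma sym_inv_ex (s : Sym) :
  exists t : Sym, cancel (sym_fun s) (sym_fun t) /\
                  cancel (sym_fun t) (sym_fun s).
Proof.
have [g sg gs] := sym_bij s.
by exists (sym_of (Bijective gs sg)).
Qed.

Definition sym_one : Sym := sym_of (Bijective (frefl id) (frefl id)).
Definition sym_mul (s t : Sym) : Sym :=
  sym_of (bij_comp (sym_bij s) (sym_bij t)).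
Definition sym_inv (s : Sym) : Sym := projT1 (cid (sym_inv_ex s)).

Lemma sym_mulA : associative sym_mul.
Proof. by move=> s t u; apply: val_inj. Qed.
Lemma sym_mul1 : left_id sym_one sym_mul.
Proof. by move=> s; apply: val_inj. Qed.
Lemma sym_1mul : right_id sym_one sym_mul.
Proof. by move=> s; apply: val_inj. Qed.
Lemma sym_mulV : left_inverse sym_one sym_inv sym_mul.
Proof.
move=> s; apply: val_inj; apply: funext => x /=.
by rewrite /sym_inv; case: cid => t [st ts] /=; exact: st.
Qed.
Lemma sym_Vmul : right_inverse sym_one sym_inv sym_mul.
Proof.
move=> s; apply: val_inj; apply: funext => x /=.
by rewrite /sym_inv; case: cid => t [st ts] /=; exact: ts.
Qed.

HB.instance Definition _ :=
  isGroup.Build Sym sym_mulA sym_mul1 sym_1mul sym_mulV sym_Vmul.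

End Symmetric.

Definition subgroup (G : groupType) (H : set G) : Prop :=
  group_closed (mem H).

Definition generated (G : groupType) (A : set G) : set G :=
  smallest (@subgroup G) A.

Definition elementary_abelian2 (G : groupType) (H : set G) : Prop :=
  [/\ subgroup H,
      forall g h, H g -> H h -> commute g h &
      forall g, H g -> g ^+ 2 = 1].

Section Torsion.
Variable S : rightLoopType.

Definition torsion_map (y z x : S) : S := rdiv ((x * y) * z) (y * z).

Lemma torsion_map_bij (y z : S) : bijective (torsion_map y z).
Proof.
exists (fun x => rdiv (rdiv (x * (y * z)) z) y) => x.
  by rewrite /torsion_map rdivK !mulKrl.
by rewrite /torsion_map !rdivK mulKrl.
Qed.

Definition group_torsion : set (Sym S) :=
  generated [set sym_of (torsion_map_bij y z) | y in [set: S] & z in [set: S]].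

End Torsion.

Arguments group_torsion S : clear implicits.

(* Main.v *)
Require Import Defs.
From mathcomp Require Import all_boot boolp classical_sets functions cardinality.

(** Let [R] be the congruence whose class of [1] is [T].  Right translation by
    [x] is injective and maps [T] onto the [R]-class of [x], so every class has
    at most two elements ([congruence_class_card2]).  Associativity of the
    quotient says that [(x * y) * z] and [x * (y * z)] are congruent, and [R]
    allows right cancellation, so each [torsion_map y z] moves every point
    inside its own class ([torsion_map_congr]).  The permutations with this
    property form a subgroup ([class_stabilizer_subgroup]), which therefore
    contains the whole group torsion.  On a set of at most two elements every
    permutation squares to the identity; applied class by class, this makes
    every element of the group torsion an involution
    ([class_stabilizer_sqr]), and a group of involutions is abelian. *)

Local Open Scope classical_set_scope.
Local Open Scope group_scope.

Lemma generated_subgroup (G : groupType) (A : set G) : subgroup (generated A).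
Proof.
split=> [|u v /set_mem gu /set_mem gv]; apply/mem_set => H HA.
  by have [[/set_mem]] := HA.
have [[_ HV] _] := HA.
by apply/set_mem/HV; apply/mem_set; [exact: gu | exact: gv].
Qed.

(** If [g], [h] and [g * h] are involutions then
    [g * h = (g * h)^-1 = h^-1 * g^-1 = h * g]. *)
Lemma sqr1_elementary_abelian2 (G : groupType) (H : set G) :
  subgroup H -> (forall g, H g -> g ^+ 2 = 1) -> elementary_abelian2 H.
Proof.
move=> gH sqH; split=> // g h Hg Hh.
have invH k : H k -> k^-1 = k.
  by move=> Hk; apply: (@mulgI _ k); rewrite mulgV -expg2 sqH.
have Hgh : H (g * h).
  by apply/set_mem/(group_closedM gH); apply/mem_set.
by rewrite /commute -(invH _ Hgh) invgM (invH _ Hg) (invH _ Hh).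
Qed.

Definition class_stabilizer (X : Type) (R : set (X * X)) : set (Sym X) :=
  [set s | forall x, R (sym_fun s x, x)].
Arguments class_stabilizer {X} R.

Lemma class_stabilizer_subgroup (X : Type) (R : set (X * X)) :
  equivalence_set R -> subgroup (class_stabilizer R).
Proof.
move=> [Rr Rs Rt]; split=> [|s t /set_mem Hs /set_mem Ht].
  by apply/mem_set => x; exact: Rr.
apply/mem_set => x; apply: Rt (Hs _) _.
have tV : sym_fun t (sym_fun t^-1 x) = x.
  exact: (congr1 (fun s => sym_fun s x) (mulgV t)).
by have := Ht (sym_fun t^-1 x); rewrite tV; exact: Rs.
Qed.

Lemma class_stabilizer_sqr (X : Type) (R : set (X * X)) (s : Sym X) :
  equivalence_set R ->
  (forall x y z, R (y, x) -> R (z, x) -> y <> x -> z <> x -> y = z) ->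
  class_stabilizer R s -> s ^+ 2 = 1.
Proof.
move=> [Rr Rs Rt] R2 Hs; rewrite expg2; apply: val_inj; apply: funext => x.
change (sym_fun s (sym_fun s x) = x).
have [sx|sx_x] := pselect (sym_fun s x = x); first by rewrite !sx.
(* [x] and [s (s x)] lie in the class of [s x], and both differ from [s x]. *)
apply: (R2 (sym_fun s x)) => //.
- exact: Rs.
- by move=> e; apply: sx_x; exact: (bij_inj (sym_bij s)).
- by move=> e; apply: sx_x.
Qed.

Lemma card2_eq (X : Type) (T : set X) (a x y : X) : (T #= `I_2)%card ->
  T a -> T x -> T y -> x <> a -> y <> a -> x = y.
Proof.
move=> /card_set_bijP[f [fT finj _]] Ta Tx Ty xa ya.
have injf u v : T u -> T v -> f u = f v -> u = v.
  by move=> Tu Tv; apply: finj; apply/mem_set.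
apply: (injf _ _ Tx Ty).
have {}xa : f x <> f a by move=> /(injf _ _ Tx Ta).
have {}ya : f y <> f a by move=> /(injf _ _ Ty Ta).
have /= := (fT _ Ta, fT _ Tx, fT _ Ty).
by case: (f a) xa ya => [|[|?]]; case: (f x) => [|[|?]];
   case: (f y) => [|[|?]] => // xa ya [[//]].
Qed.

Section Congruence.
Variables (S : rightLoopType) (R : set (S * S)).
Hypothesis cR : congruence R.

(** The unique solution in [R] of [X * (a, a) = (x * a, y * a)] must be
    [(x, y)], because solutions in [S * S] are unique. *)
Lemma congruence_mulIr (a x y : S) : R (x * a, y * a) -> R (x, y).
Proof.
have [[Rr _ _] [_ _ Rd]] := cR.
move=> /(Rd _ _ (Rr a))[[p q] [[Rpq [e1 e2]] _]].
by rewrite -(mulIrl e1) -(mulIrl e2).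
Qed.

(** Right division by [x] carries the class of [x] injectively into the class
    of [1], and sends [x] to [1]. *)
Lemma congruence_class_card2 (x y z : S) :
  ([set u | R (u, 1)] #= `I_2)%card ->
  R (y, x) -> R (z, x) -> y <> x -> z <> x -> y = z.
Proof.
move=> cardT Ryx Rzx yx zx.
have [[Rr _ _] _] := cR.
have divR u : R (u, x) -> R (rdiv u x, 1).
  by move=> Rux; apply: (@congruence_mulIr x); rewrite rdivK rl_mul1g.
have div1 u : u <> x -> rdiv u x <> 1.
  by move=> ux e; apply: ux; rewrite -(rdivK x u) e rl_mul1g.
rewrite -(rdivK x y) -(rdivK x z); congr (_ * _).
by apply: (card2_eq _ _ 1 _ _ cardT); [exact: Rr | exact: divR | exact: divR
  | exact: div1 | exact: div1].
Qed.

Lemma torsion_map_congr (y z x : S) :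
  R ((x * y) * z, x * (y * z)) -> R (torsion_map y z x, x).
Proof.
by move=> Rxyz; apply: (@congruence_mulIr (y * z)); rewrite /torsion_map rdivK.
Qed.

End Congruence.

Lemma quotient_assoc_congr (S : rightLoopType) (R : set (S * S))
    (invT : invariant_sub_right_loop [set u | R (u, 1)]) (x y z : S) :
  congruence R -> associative (@mul (quotient invT)) ->
  R ((x * y) * z, x * (y * z)).
Proof.
move=> cR mulA; apply/(coset_eqP _ _ cR).
have e := mulA (quotient_class invT x) (quotient_class invT y)
  (quotient_class invT z).
(* Explicit arguments, since the inner products also match up to conversion
   with [quotient_class] of a product of representatives. *)
rewrite (quotient_mulE invT y z) (quotient_mulE invT x y) in e.
rewrite (quotient_mulE invT x (y * z)) (quotient_mulE invT (x * y) z) in e.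
exact: (congr1 val (esym e)).
Qed.

Theorem theorem1p2 (S : rightLoopType) (T : set S)
    (invT : invariant_sub_right_loop T) (cardT : (T #= `I_2)%card)
    (grpQ : is_group (quotient invT)) :
  elementary_abelian2 (group_torsion S).
Proof.
have [R cR TE] := invT; subst T; have [mulA _] := grpQ.
have eqR : equivalence_set R by case: cR.
have torsionR : group_torsion S `<=` class_stabilizer R.
  apply: smallest_sub; first exact: class_stabilizer_subgroup.
  move=> _ [y _ [z _ <-]] x.
  by apply: torsion_map_congr => //; exact: (quotient_assoc_congr _ _ invT).
apply: sqr1_elementary_abelian2; first exact: generated_subgroup.
move=> g /torsionR; apply: class_stabilizer_sqr => // x y z.
exact: congruence_class_card2.
Qed.
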